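(* Consider a degree-corrected stochastic block model with $K$ communities, membership matrix $\Theta\in\mathbb M_{n,K}$ (every community nonempty), symmetric $B\in[0,1]^{K\times K}$ with $\mathrm{rank}(B)=K'\le K$, and node propensities $\vartheta\in\mathbb R^n_{+}$ with $\max_{i\in G_k}\vartheta_i=1$ for each $k$. Let $P=\mathrm{diag}(\vartheta)\Theta B\Theta^\intercal\mathrm{diag}(\vartheta)=U\Sigma U^\intercal$ be its eigenvalue decomposition with $U\in\mathbb R^{n\times K'}$ having orthonormal columns. Let $\phi_k\in\mathbb R^n$ agree with $\vartheta$ on $G_k$ and be zero elsewhere, $\Omega=\mathrm{diag}(\|\phi_1\|_2,\dots,\|\phi_K\|_2)$, $\bar B=\Omega B\Omega$, and let $\bar B=HDH^\intercal$ be its eigenvalue decomposition with $H\in\mathbb R^{K\times K'}$. Then: (a) If $K'=K$, then $\cos(U_{i\ast},U_{j\ast})=1$ whenever $\Theta_{i\ast}=\Theta_{j\ast}$ and $\cos(U_{i\ast},U_{j\ast})=0$ whenever $\Theta_{i\ast}\ne\Theta_{j\ast}$. (b) If $K'<K$, then $\cos(U_{i\ast},U_{j\ast})=1$ whenever $\Theta_{i\ast}=\Theta_{j\ast}$; and if the rows of $H$ are not pairwise proportional in the sense that there is a deterministic sequence $\xi'_n<1$ with $\max_{k\ne l}\cos(H_{k\ast},H_{l\ast})\le\xi'_n$, then for $\Theta_{i\ast}\ne\Theta_{j\ast}$, $\cos(U_{i\ast},U_{j\ast})=\cos(H_{g_i\ast},H_{g_j\ast})\le\xi'_n<1$.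
   Context: $\mathbb M_{n,K}$: $n\times K$ 0/1 matrices with exactly one $1$ per row; node $i$ belongs to community $g_i$ iff $\Theta_{ig_i}=1$; $G_k=\{i:g_i=k\}$. $M_{i\ast}$ denotes the $i$-th row. For vectors $a,b$, $\cos(a,b)=a^\intercal b/(\|a\|_2\|b\|_2)$. *)

(* Defs.v *)
From HB Require Import structures.
From mathcomp Require Import all_boot all_order all_algebra.
Set Implicit Arguments. Unset Strict Implicit. Unset Printing Implicit Defensive.
Import Order.TTheory GRing.Theory Num.Theory.
Local Open Scope ring_scope.

Definition vdot (R : rcfType) (m : nat) (a b : 'rV[R]_m) : R :=
  \sum_(j < m) a 0 j * b 0 j.
Definition vnorm (R : rcfType) (m : nat) (a : 'rV[R]_m) : R :=
  Num.sqrt (vdot a a).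
(* cos(a,b) = a^T b / (||a|| ||b||)  (division by 0 yields 0 in MathComp) *)
Definition vcos (R : rcfType) (m : nat) (a b : 'rV[R]_m) : R :=
  vdot a b / (vnorm a * vnorm b).

Definition memb_mx (R : rcfType) (n K : nat) (g : 'I_n -> 'I_K) : 'M[R]_(n, K) :=
  \matrix_(i < n, k < K) (g i == k)%:R.

Definition phi_vec (R : rcfType) (n K : nat) (g : 'I_n -> 'I_K) (theta : 'rV[R]_n)
  (k : 'I_K) : 'rV[R]_n :=
  \row_(i < n) (if g i == k then theta 0 i else 0).

Definition Omega_mx (R : rcfType) (n K : nat) (g : 'I_n -> 'I_K) (theta : 'rV[R]_n)
  : 'M[R]_K :=
  diag_mx (\row_(k < K) vnorm (phi_vec g theta k)).

Definition dcsbm_P (R : rcfType) (n K : nat) (g : 'I_n -> 'I_K) (theta : 'rV[R]_n)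
  (B : 'M[R]_K) : 'M[R]_n :=
  diag_mx theta *m memb_mx R g *m B *m (memb_mx R g)^T *m diag_mx theta.

Definition Bbar_mx (R : rcfType) (n K : nat) (g : 'I_n -> 'I_K) (theta : 'rV[R]_n)
  (B : 'M[R]_K) : 'M[R]_K :=
  Omega_mx g theta *m B *m Omega_mx g theta.

(* Main.v *)
Require Import Defs.
From HB Require Import structures.
From mathcomp Require Import all_boot all_order all_algebra.
Import Order.TTheory GRing.Theory Num.Theory.
Set Implicit Arguments.
Unset Strict Implicit.
Unset Printing Implicit Defensive.
Local Open Scope ring_scope.

(* Write Psi := diag(theta) Theta Omega^-1. Its columns are the normalized
   vectors phi_k / ||phi_k||, so Psi is orthonormal and P = Psi Bbar Psi^T.
   Hence W := Psi H is orthonormal with P = W D W^T, and comparing with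
   P = U Sigma U^T (nonzero eigenvalues) shows that U and W span the same
   column space: U = W Q with Q orthogonal. Row i of W is a positive multiple
   of row g_i of H, and right multiplication by an orthogonal matrix preserves
   cosines, so cos(U_i, U_j) = cos(H_{g_i}, H_{g_j}). When K' = K, H is square
   orthogonal, so its rows are orthonormal. *)

Section RowCosine.
Variable R : rcfType.
Implicit Types (m p : nat).

Lemma vdot_mx m (a b : 'rV[R]_m) : vdot a b = (a *m b^T) 0 0.
Proof. by rewrite /vdot !mxE; apply: eq_bigr => j _; rewrite mxE. Qed.

Lemma vdot_row m p (A B : 'M[R]_(p, m)) i j :
  vdot (row i A) (row j B) = (A *m B^T) i j.
Proof. by rewrite /vdot !mxE; apply: eq_bigr => l _; rewrite !mxE. Qed.

Lemma vdotC m (a b : 'rV[R]_m) : vdot a b = vdot b a.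
Proof. by apply: eq_bigr => j _; rewrite mulrC. Qed.

Lemma vdotZl m c (a b : 'rV[R]_m) : vdot (c *: a) b = c * vdot a b.
Proof. by rewrite /vdot mulr_sumr; apply: eq_bigr => j _; rewrite mxE mulrA. Qed.

Lemma vdotZr m c (a b : 'rV[R]_m) : vdot a (c *: b) = c * vdot a b.
Proof. by rewrite vdotC vdotZl vdotC. Qed.

Lemma vdot_ge0 m (a : 'rV[R]_m) : 0 <= vdot a a.
Proof. by apply: sumr_ge0 => j _; rewrite -expr2 sqr_ge0. Qed.

Lemma vdot_eq0 m (a : 'rV[R]_m) : (vdot a a == 0) = (a == 0).
Proof.
apply/eqP/eqP => [a0|->]; last by rewrite /vdot big1 // => j _; rewrite mxE mul0r.
apply/rowP => j; rewrite mxE; apply/eqP; rewrite -[_ == 0]orbb -mulf_eq0.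
by apply/eqP; apply: (psumr_eq0P _ a0) => // l _; rewrite -expr2 sqr_ge0.
Qed.

Lemma vnorm_gt0 m (a : 'rV[R]_m) : a != 0 -> 0 < vnorm a.
Proof. by move=> a0; rewrite sqrtr_gt0 lt0r vdot_eq0 a0 vdot_ge0. Qed.

Lemma vnormZ m c (a : 'rV[R]_m) : vnorm (c *: a) = `|c| * vnorm a.
Proof. by rewrite /vnorm vdotZl vdotZr mulrA -expr2 sqrtrM ?sqr_ge0 // sqrtr_sqr. Qed.

Lemma vdot_mulmx_orth m p (a b : 'rV[R]_m) (M : 'M[R]_(m, p)) :
  M *m M^T = 1%:M -> vdot (a *m M) (b *m M) = vdot a b.
Proof. by move=> MMT; rewrite !vdot_mx trmx_mul !mulmxA -(mulmxA a) MMT mulmx1. Qed.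

Lemma vcos_mulmx_orth m p (a b : 'rV[R]_m) (M : 'M[R]_(m, p)) :
  M *m M^T = 1%:M -> vcos (a *m M) (b *m M) = vcos a b.
Proof. by move=> MMT; rewrite /vcos /vnorm !vdot_mulmx_orth. Qed.

Lemma vcosZ m c e (a b : 'rV[R]_m) : 0 < c -> 0 < e ->
  vcos (c *: a) (e *: b) = vcos a b.
Proof.
move=> c_gt0 e_gt0; rewrite /vcos vdotZl vdotZr !vnormZ !gtr0_norm //.
by rewrite mulrA mulrACA invfM mulrACA mulfV ?mul1r // mulf_neq0 ?gt_eqF.
Qed.

Lemma vcos_row_orthogonal m (M : 'M[R]_m) k l :
  M^T *m M = 1%:M -> k != l -> vcos (row k M) (row l M) = 0.
Proof.
by move=> /mulmx1C MMT kl; rewrite /vcos vdot_row MMT mxE (negbTE kl) mul0r.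
Qed.

Lemma vcos_self m (a : 'rV[R]_m) : a != 0 -> vcos a a = 1.
Proof.
move=> a0; rewrite /vcos /vnorm -expr2 sqr_sqrtr ?vdot_ge0 // mulfV //.
by rewrite vdot_eq0.
Qed.

End RowCosine.

Section EigenSpan.
Variables (R : rcfType) (n p q : nat).

Lemma mulmx_orthonormal (A : 'M[R]_(n, p)) (B : 'M[R]_(p, q)) :
  A^T *m A = 1%:M -> B^T *m B = 1%:M -> (A *m B)^T *m (A *m B) = 1%:M.
Proof.
by move=> AA BB; rewrite trmx_mul mulmxA -(mulmxA B^T) AA mulmx1.
Qed.

(* U = P U Sigma^-1 = W (D W^T U Sigma^-1), and W^T W = 1 identifies the
   bracket with W^T U. *)
Lemma eigvec_mulmx_proj (U : 'M[R]_(n, p)) (W : 'M[R]_(n, q)) (s : 'rV[R]_p)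
    (A : 'M[R]_q) :
  U^T *m U = 1%:M -> W^T *m W = 1%:M -> (forall k, s 0 k != 0) ->
  U *m diag_mx s *m U^T = W *m A *m W^T -> U = W *m (W^T *m U).
Proof.
move=> UU WW s_neq0 eUW.
have sV : diag_mx s *m diag_mx (\row_k (s 0 k)^-1) = 1%:M.
  apply/matrixP => i j; rewrite mul_diag_mx !mxE.
  by case: eqP => [->|_]; rewrite ?mulr1n ?mulr0n ?mulr0 // ?mxE mulfV.
set C := A *m W^T *m U *m diag_mx (\row_k (s 0 k)^-1).
have eU : U = W *m C.
  rewrite -{1}(mulmx1 U) -sV mulmxA -{1}(mulmx1 (U *m diag_mx s)) -UU.
  by rewrite !mulmxA eUW.
by rewrite {2}eU (mulmxA W^T) WW mul1mx -eU.
Qed.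

Lemma coord_mx_orthonormal (U : 'M[R]_(n, p)) (W : 'M[R]_(n, q)) :
  U^T *m U = 1%:M -> U = W *m (W^T *m U) ->
  (W^T *m U)^T *m (W^T *m U) = 1%:M.
Proof. by move=> UU eU; rewrite trmx_mul trmxK -mulmxA -eU UU. Qed.

End EigenSpan.

Section DCBlockModel.
Variables (R : rcfType) (n K : nat) (g : 'I_n -> 'I_K) (theta : 'rV[R]_n).
Hypothesis g_surj : forall k : 'I_K, exists i : 'I_n, g i = k.
Hypothesis theta_gt0 : forall i : 'I_n, 0 < theta 0 i.

Local Notation omega k := (vnorm (phi_vec g theta k)).

Lemma omega_gt0 k : 0 < omega k.
Proof.
have [i gi] := g_surj k; apply: vnorm_gt0; apply/eqP => /rowP /(_ i).
by rewrite !mxE gi eqxx; apply/eqP; rewrite gt_eqF.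
Qed.

Definition scaled_memb_mx : 'M[R]_(n, K) :=
  \matrix_(i, k) ((g i == k)%:R * theta 0 i / omega k).

Local Notation Psi := scaled_memb_mx.

Lemma scaled_memb_mx_Omega : Psi *m Omega_mx g theta = diag_mx theta *m memb_mx R g.
Proof.
rewrite /Omega_mx mul_mx_diag mul_diag_mx; apply/matrixP => i k; rewrite !mxE.
by rewrite divfK 1?mulrC // gt_eqF ?omega_gt0.
Qed.

Lemma scaled_memb_mx_orthonormal : Psi^T *m Psi = 1%:M.
Proof.
apply/matrixP => k l; rewrite !mxE.
have [<-|kl] := eqVneq k l; last first.
  rewrite mulr0n big1 // => i _; rewrite !mxE.
  by have [->|] := eqVneq (g i) k; rewrite ?(negbTE kl) !mul0r ?mulr0.
rewrite mulr1n.
transitivity (vdot (phi_vec g theta k) (phi_vec g theta k) / omega k ^+ 2).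
  rewrite /vdot mulr_suml; apply: eq_bigr => i _; rewrite !mxE.
  by case: eqP => _; rewrite ?mul0r ?mulr0 // !mul1r expr2 invfM mulrACA.
by rewrite sqr_sqrtr ?vdot_ge0 // mulfV // gt_eqF // -sqrtr_gt0 omega_gt0.
Qed.

Lemma dcsbm_P_scaled_memb B : dcsbm_P g theta B = Psi *m Bbar_mx g theta B *m Psi^T.
Proof.
have -> : dcsbm_P g theta B =
    Psi *m Omega_mx g theta *m B *m (Psi *m Omega_mx g theta)^T.
  by rewrite scaled_memb_mx_Omega trmx_mul tr_diag_mx /dcsbm_P !mulmxA.
by rewrite trmx_mul /Bbar_mx /Omega_mx tr_diag_mx !mulmxA.
Qed.

Lemma row_scaled_memb_mul p (H : 'M[R]_(K, p)) i :
  row i (Psi *m H) = (theta 0 i / omega (g i)) *: row (g i) H.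
Proof.
apply/rowP => j; rewrite !mxE (bigD1 (g i)) //= big1 => [|k /negbTE kg].
  by rewrite addr0 !mxE eqxx mul1r.
by rewrite !mxE eq_sym kg !mul0r.
Qed.

Lemma vcos_row_scaled_memb p (H : 'M[R]_(K, p)) (Q : 'M[R]_p) i j :
  Q *m Q^T = 1%:M ->
  vcos (row i (Psi *m H *m Q)) (row j (Psi *m H *m Q)) =
  vcos (row (g i) H) (row (g j) H).
Proof.
move=> QQ; rewrite ![row _ (_ *m Q)]row_mul !row_scaled_memb_mul -!scalemxAl.
by rewrite vcosZ ?vcos_mulmx_orth // divr_gt0 ?omega_gt0.
Qed.

Lemma row_Bbar_neq0 B k : row k B != 0 -> row k (Bbar_mx g theta B) != 0.
Proof.
move=> /eqP Bk0; apply/eqP => /rowP Bbark0; apply: Bk0; apply/rowP => l.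
move: (Bbark0 l); rewrite /Bbar_mx /Omega_mx mul_mx_diag mul_diag_mx !mxE.
by move/eqP; rewrite !mulf_eq0 !(gt_eqF (omega_gt0 _)) orbF => /eqP.
Qed.

End DCBlockModel.

Lemma memb_row_eq (R : rcfType) n K (g : 'I_n -> 'I_K) i j :
  (row i (memb_mx R g) == row j (memb_mx R g)) = (g i == g j).
Proof.
apply/eqP/eqP => [/rowP/(_ (g i))|e]; last by apply/rowP => k; rewrite !mxE e.
by rewrite !mxE eqxx; case: eqP => // _ /eqP; rewrite oner_eq0.
Qed.

Theorem lemma3 (R : rcfType) (n K K' : nat)
  (g : 'I_n -> 'I_K) (theta : 'rV[R]_n) (B : 'M[R]_K)
  (U : 'M[R]_(n, K')) (sigma : 'rV[R]_K')
  (H : 'M[R]_(K, K')) (d : 'rV[R]_K')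
  (* every community nonempty *)
  (Hne : forall k : 'I_K, exists i : 'I_n, g i = k)
  (* B symmetric with entries in [0,1], rank K' <= K *)
  (HBsym : B^T = B)
  (HB01 : forall k l : 'I_K, 0 <= B k l <= 1)
  (HBrank : \rank B = K')
  (HKK : (K' <= K)%N)
  (* no row of B vanishes (needed for the cosines to be defined; see NOTES) *)
  (HBrow : forall k : 'I_K, row k B != 0)
  (* positive propensities, with max_{i in G_k} theta_i = 1 *)
  (Hpos : forall i : 'I_n, 0 < theta 0 i)
  (Hmax1 : forall k : 'I_K, (forall i : 'I_n, g i = k -> theta 0 i <= 1) /\
                           (exists i : 'I_n, g i = k /\ theta 0 i = 1))
  (* eigendecomposition P = U Sigma U^T, U with orthonormal columns *)
  (HUorth : U^T *m U = 1%:M)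
  (Hsigma : forall k : 'I_K', sigma 0 k != 0)
  (HP : dcsbm_P g theta B = U *m diag_mx sigma *m U^T)
  (* eigendecomposition Bbar = H D H^T *)
  (HHorth : H^T *m H = 1%:M)
  (Hd : forall k : 'I_K', d 0 k != 0)
  (HBbar : Bbar_mx g theta B = H *m diag_mx d *m H^T) :
  (* (a) *)
  (K' = K ->
     forall i j : 'I_n,
       (row i (memb_mx R g) = row j (memb_mx R g) -> vcos (row i U) (row j U) = 1) /\
       (row i (memb_mx R g) != row j (memb_mx R g) -> vcos (row i U) (row j U) = 0)) /\
  (* (b) *)
  ((K' < K)%N ->
     (forall i j : 'I_n,
        row i (memb_mx R g) = row j (memb_mx R g) -> vcos (row i U) (row j U) = 1) /\
     (forall xi : R, xi < 1 ->
        (forall k l : 'I_K, k != l -> vcos (row k H) (row l H) <= xi) ->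
        forall i j : 'I_n, row i (memb_mx R g) != row j (memb_mx R g) ->
          vcos (row i U) (row j U) = vcos (row (g i) H) (row (g j) H) /\
          vcos (row (g i) H) (row (g j) H) <= xi)).
Proof.
set W := scaled_memb_mx g theta *m H.
have WW : W^T *m W = 1%:M.
  exact: mulmx_orthonormal (scaled_memb_mx_orthonormal Hne Hpos) HHorth.
have eP : U *m diag_mx sigma *m U^T = W *m diag_mx d *m W^T.
  by rewrite -HP (dcsbm_P_scaled_memb Hne Hpos) HBbar /W trmx_mul !mulmxA.
have eU := eigvec_mulmx_proj HUorth WW Hsigma eP.
have QQ := mulmx1C (coord_mx_orthonormal HUorth eU).
have cosU i j : vcos (row i U) (row j U) = vcos (row (g i) H) (row (g j) H).
  by rewrite eU /W vcos_row_scaled_memb.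
have H_row_neq0 k : row k H != 0.
  apply: contraNneq (row_Bbar_neq0 Hne Hpos (HBrow k)) => Hk0.
  by rewrite HBbar !row_mul Hk0 !mul0mx.
have cosU_same i j : row i (memb_mx R g) = row j (memb_mx R g) ->
    vcos (row i U) (row j U) = 1.
  by move/eqP; rewrite memb_row_eq cosU => /eqP ->; rewrite vcos_self.
split=> [eK i j|_].
  split; first exact: cosU_same.
  rewrite memb_row_eq cosU => gij.
  by clear HBrank; subst K'; rewrite vcos_row_orthogonal.
split=> [|xi _ cosH_le i j]; first exact: cosU_same.
by rewrite memb_row_eq cosU => gij; split=> //; apply: cosH_le.
Qed.
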